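(* For integers $n\ge 0$ and $r\ge 0$, $$E\big[\langle Y\rangle_{n,\lambda}\big]=n!\sum_{k=0}^{n}\frac{d_{k+r,\lambda}^{(r,Y)}}{(k+r)!}(-1)^{k}\binom{r+1}{n-k}.$$
   Context: Let $\lambda$ be a nonzero real number. Set $(x)_{0,\lambda}=1$, $(x)_{k,\lambda}=x(x-\lambda)\cdots(x-(k-1)\lambda)$ and $\langle x\rangle_{0,\lambda}=1$, $\langle x\rangle_{k,\lambda}=x(x+\lambda)\cdots(x+(k-1)\lambda)$ for $k\ge 1$. The degenerate exponential is $e_{\lambda}^{x}(t)=\sum_{k\ge 0}(x)_{k,\lambda}\frac{t^{k}}{k!}$ (so $e_\lambda^x(t)=(1+\lambda t)^{x/\lambda}$ for $t$ near $0$). $Y$ is a real random variable whose moment generating function $E[e^{tY}]=\sum_{n\ge 0}E[Y^n]\frac{t^n}{n!}$ exists for all $t$ in some neighborhood of $0$. $E$ denotes expectation. For an integer $r\ge 0$, the probabilistic degenerate $r$-derangement numbers associated with $Y$, $d_{n,\lambda}^{(r,Y)}$, are defined by $$\frac{t^{r}}{(1-t)^{r+1}}E\big[e_{\lambda}^{-Y}(t)\big]=\sum_{n=0}^{\infty}d_{n,\lambda}^{(r,Y)}\frac{t^{n}}{n!}$$ (power series in $t$ near $0$). Binomial coefficients $\binom{a}{b}$ with $b>a\ge 0$ are $0$. *)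

(* Defs.v *)
From HB Require Import structures.
From mathcomp Require Import all_boot all_order all_algebra.
From mathcomp Require Import all_classical all_reals all_analysis.

Set Implicit Arguments.
Unset Strict Implicit.
Unset Printing Implicit Defensive.

Import Order.TTheory GRing.Theory Num.Theory.
Import numFieldNormedType.Exports.

Local Open Scope classical_set_scope.
Local Open Scope ring_scope.

Definition degen_falling (R : realType) (lambda x : R) (k : nat) : R :=
  \prod_(0 <= i < k) (x - i%:R * lambda).

Definition degen_rising (R : realType) (lambda x : R) (k : nat) : R :=
  \prod_(0 <= i < k) (x + i%:R * lambda).

(* e_lambda^x(t); only meaningful where the series converges, in particular
   for `|lambda * t| < 1. *)
Definition degen_exp (R : realType) (lambda x t : R) : R :=
  limn [series degen_falling lambda x k * (t ^+ k / k`!%:R)]_k.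

Definition finite_mgf_near0 (d : measure_display) (T : measurableType d)
    (R : realType) (P : probability T R) (Y : {RV P >-> R}) : Prop :=
  \forall t \near (0 : R), ('M_P Y t < +oo)%E.

(* The equation is in \bar R, so that, for t != 0, a convergent series on the
   left forces the expectation to be finite. *)
Definition derangement_genfun (d : measure_display) (T : measurableType d)
    (R : realType) (P : probability T R) (lambda : R) (r : nat)
    (Y : {RV P >-> R}) (a : nat -> R) : Prop :=
  \forall t \near (0 : R),
    let u := [series a n * (t ^+ n / n`!%:R)]_n in
    cvgn u /\
    ((limn u)%:E =
     (t ^+ r / (1 - t) ^+ r.+1)%:E * 'E_P[fun w => degen_exp lambda (- Y w) t])%E.

(* The numbers d_{n,lambda}^{(r,Y)}: the sequence with the above exponential
   generating function. It is unique, since its power series is determined by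
   its values near 0; the default 0 is only used if there is none. *)
Definition prob_degen_derangement (d : measure_display) (T : measurableType d)
    (R : realType) (P : probability T R) (lambda : R) (r : nat)
    (Y : {RV P >-> R}) : nat -> R :=
  xget (fun=> 0) [set a | derangement_genfun lambda r Y a].

(* Main.v *)
Require Import Defs.
From HB Require Import structures.
From mathcomp Require Import all_boot all_order all_algebra.
From mathcomp Require Import all_classical all_reals all_analysis.
From mathcomp Require Import measurable_realfun ring lra.

Import Order.TTheory GRing.Theory Num.Theory.
Import numFieldNormedType.Exports.

Local Open Scope classical_set_scope.
Local Open Scope ring_scope.

(** Write [m k] for [E[(-Y)_(k, lambda)] / k!], which is
    [(-1) ^ k E[<Y>_(k, lambda)] / k!].  Near [0] the expectation of
    [e_lambda ^ (- Y) (t)] is the power series with coefficients [m], so the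
    defining equation of the derangement numbers says that [d_n / n!] are the
    coefficients of [t ^ r (1 - t) ^ (- (r + 1)) \sum_k m k t ^ k].  Division by
    [1 - t] turns coefficients into their partial sums and multiplication by
    [t] shifts them, hence [d_n / n!] is the [r]-fold shift of the [(r + 1)]-fold
    partial sums of [m] ([prob_degen_derangementE]).  Undoing the partial sums
    amounts to multiplying by [(1 - t) ^ (r + 1)], whose coefficients are signed
    binomials ([iter_partial_sums_inv]); this expresses [m n] as a combination of
    the [d_(k + r) / (k + r)!] with [k <= n], which is the theorem.

    Two analytic facts carry this.  Firstly, a power series is determined by its
    values near [0] ([psum_near0_unique]), so that the sequence chosen in the
    definition of the derangement numbers is the one computed above.  Secondly,
    expectation and degenerate exponential series can be exchanged
    ([cvg_expectation_degen_exp]).  This is dominated convergence: since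
    [z ^ k <= k! exp z] for [z >= 0], taking [z = c (|x| + k |lambda|)] gives
    [|(x)_(k, lambda)| <= k! (exp (c |lambda|) / c) ^ k exp (c |x|)], so for [t]
    small enough the terms of the series are below a geometric series times
    [exp (c |Y|)], and the latter is integrable for small [c > 0] because the
    moment generating function of [Y] is finite on both sides of [0]. *)

(** * Power series near the origin *)

Section PowerSeries.
Context {R : realType}.
Implicit Types (c : nat -> R) (f : R -> R) (t : R).

(** On a punctured neighbourhood of [0] the terms of positive degree sum to
    [O(t)], so the constant term of a series vanishing there is [O(t)] too. *)
Lemma pseries_head0 c :
  (\forall t \near 0^', pseries c t @ \oo --> (0 : R)) -> c 0%N = 0.
Proof.
move=> /nbhs_ballP[e /= e_gt0 ce].
have cvgc t : 0 < t < e -> pseries c t @ \oo --> (0 : R).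
  move=> /andP[t_gt0 te]; apply: ce; last by rewrite gt_eqF.
  by rewrite /ball /= sub0r normrN gtr0_norm.
pose s := e / 4; have s_gt0 : 0 < s by rewrite divr_gt0.
have se : s < e by rewrite /s; lra.
have cvg_half : cvgn (pseries c (e / 2)).
  by apply/cvg_ex; exists 0; apply: cvgc; apply/andP; split; lra.
have /(is_cvg_pseries_inside_norm cvg_half) : `|s| < `|e / 2|.
  by rewrite !gtr0_norm /s; lra.
move=> /cvg_seq_bounded /pinfty_ex_gt0 [B B_gt0 cB].
have bound n : \sum_(0 <= i < n) `|c i| * s ^+ i <= B.
  exact: le_trans (ler_norm _) (cB n I).
apply/eqP/negPn/negP => c0; have {}c0 : 0 < `|c 0%N| by rewrite normr_gt0.
(* A point [u * s] so close to [0] that the tail, at most [u * B], cannot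
   compensate the constant term. *)
pose u := `|c 0%N| / (`|c 0%N| + B).
have D_gt0 : 0 < `|c 0%N| + B by rewrite addr_gt0.
have u_gt0 : 0 < u by rewrite divr_gt0.
have u_le1 : u <= 1 by rewrite ler_pdivrMr// mul1r lerDl ltW.
have tail n : `|c 0%N - pseries c (u * s) n.+1| <= u * B.
  rewrite /pseries /series /= big_nat_recl//= expr0 mulr1 opprD addNKr normrN.
  apply: (le_trans (ler_norm_sum _ _ _)).
  apply: (@le_trans _ _ (u * \sum_(0 <= i < n) `|c i.+1| * s ^+ i.+1)); last first.
    rewrite (ler_wpM2l (ltW u_gt0))//; apply: (le_trans _ (bound n.+1)).
    by rewrite big_nat_recl//= lerDr mulr_ge0// expr0.
  rewrite mulr_sumr; apply: ler_sum => i _.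
  rewrite normrM normrX (gtr0_norm (mulr_gt0 u_gt0 s_gt0)) exprMn.
  rewrite [leRHS]mulrCA ler_wpM2l//.
  rewrite ler_wpM2r ?exprn_ge0 ?(ltW s_gt0)// exprS ler_piMr ?(ltW u_gt0)//.
  by rewrite exprn_ile1 ?(ltW u_gt0).
have : `|c 0%N - 0| <= u * B.
  have cvgt : `|c 0%N - pseries c (u * s) n.+1| @[n --> \oo] --> `|c 0%N - 0|.
    apply: cvg_norm; apply: cvgB; first exact: cvg_cst.
    rewrite cvg_shiftS; apply: cvgc; rewrite mulr_gt0//=.
    by apply: (le_lt_trans _ se); rewrite ler_piMl// ltW.
  rewrite -(cvg_lim _ cvgt)//; apply: limr_le.
    by apply/cvg_ex; eexists; exact: cvgt.
  by apply: nearW => n; exact: tail.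
rewrite subr0 /u mulrAC ler_pdivlMr// ler_pM2l//.
by rewrite leNgt ltrDr c0.
Qed.

(** The puncture in the hypothesis lets the induction divide the series by
    [t] once its constant term is known to vanish. *)
Lemma pseries_eq0 c :
  (\forall t \near 0^', pseries c t @ \oo --> (0 : R)) -> forall n, c n = 0.
Proof.
move=> cvgc n; elim: n c cvgc => [|n IHn] c cvgc; first exact: pseries_head0.
have c0 := pseries_head0 _ cvgc.
apply: (IHn (c \o S)); near=> t.
have t_neq0 : t != 0 by near: t; exact: nbhs_dnbhs_neq.
have -> : pseries (c \o S) t = (fun n => pseries c t n.+1 / t).
  apply/funext => m; rewrite /pseries /series /= big_nat_recl//= c0 mul0r add0r.
  by rewrite mulr_suml; apply: eq_bigr => i _; rewrite exprS; field.
rewrite -(mul0r t^-1); apply: cvgMr_tmp; rewrite (cvg_shiftS (pseries c t)).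
by near: t.
Unshelve. all: by end_near. Qed.

Definition psum_near0 c f : Prop :=
  \forall t \near (0 : R), pseries c t @ \oo --> f t.

Lemma psum_near0_unique c c' f :
  psum_near0 c f -> psum_near0 c' f -> c =1 c'.
Proof.
move=> cf c'f n; apply/eqP; rewrite -subr_eq0; apply/eqP.
apply: (pseries_eq0 (fun i => c i - c' i)); apply: nbhs_dnbhs.
near=> t; rewrite -(subrr (f t)).
have -> : pseries (fun i => c i - c' i) t = pseries c t - pseries c' t.
  apply/funext => m; rewrite /pseries /series /= fctE -sumrB.
  by apply: eq_bigr => i _; rewrite mulrBl.
by apply: cvgB; near: t.
Unshelve. all: by end_near. Qed.

Definition shift_coef c : nat -> R := fun n => if n is m.+1 then c m else 0.

Definition partial_sums c : nat -> R := fun n => \sum_(0 <= i < n.+1) c i.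

Lemma psum_near0_shift c f :
  psum_near0 c f -> psum_near0 (shift_coef c) (fun t => t * f t).
Proof.
apply: filterS => t cft; rewrite -(cvg_shiftS (pseries _ t)).
rewrite (_ : [sequence _]_n = fun n => t * pseries c t n).
  exact: cvgMl_tmp.
apply/funext => n /=; rewrite /pseries /series /= big_nat_recl//= mul0r add0r.
by rewrite mulr_sumr; apply: eq_bigr => i _; rewrite exprS mulrCA.
Qed.

(** Abel summation; the last term is the boundary term, which tends to [0]
    inside the disc of convergence. *)
Lemma pseries_partial_sums c t n :
  (1 - t) * pseries (partial_sums c) t n =
  pseries c t n - \sum_(0 <= i < n) c i * t ^+ n.
Proof.
elim: n => [|n IHn]; first by rewrite /pseries /series /= !big_geq// mulr0 subrr.
have partial_sumsE : partial_sums c n = \sum_(0 <= i < n) c i + c n.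
  by rewrite /partial_sums big_nat_recr.
rewrite /pseries !seriesSr mulrDr IHn /= partial_sumsE -!mulr_suml.
by rewrite big_nat_recr//= exprS -/(pseries c t n); ring.
Qed.

Lemma psum_near0_partial_sums c f :
  psum_near0 c f -> psum_near0 (partial_sums c) (fun t => f t / (1 - t)).
Proof.
move=> cf; have /nbhs_ballP[e /= e_gt0 ce] := cf.
(* The coefficients are summable against the powers of [s / 2 <= 1], so the
   boundary term is [O(r ^ n)] for [r = |t| / (s / 2)]. *)
pose s := Num.min (e / 2) 1.
have s_gt0 : 0 < s by rewrite lt_min divr_gt0/=.
have se : s <= e / 2 by rewrite ge_min lexx.
have s1 : s <= 1 by rewrite ge_min lexx orbT.
have s4_gt0 : 0 < s / 4 by rewrite divr_gt0.
have cvgs : cvgn (pseries c s).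
  apply/cvg_ex; exists (f s); apply: ce.
  by rewrite /ball /= sub0r normrN gtr0_norm//; lra.
have /(is_cvg_pseries_inside_norm cvgs) : `|s / 2| < `|s| by rewrite !gtr0_norm; lra.
move=> /cvg_seq_bounded /pinfty_ex_gt0 [B B_gt0 cB].
near=> t.
have ts : `|t| < s / 4.
  by near: t; exact: (@nbhs0_lt _ R _ s4_gt0).
have t1 : 1 - t != 0.
  by apply/eqP => /subr0_eq t1; move: ts; rewrite -t1 normr1; lra.
have -> : pseries (partial_sums c) t =
    (fun n => (pseries c t n - \sum_(0 <= i < n) c i * t ^+ n) / (1 - t)).
  by apply/funext => n; rewrite -pseries_partial_sums mulrC mulKf.
apply: cvgMr_tmp; rewrite -[X in _ --> X]subr0; apply: cvgB; first by near: t.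
pose r := `|t| / (s / 2).
have r_ge0 : 0 <= r by rewrite divr_ge0// divr_ge0// ltW.
have tE : `|t| = s / 2 * r by rewrite mulrC divfK// gt_eqF// divr_gt0.
have r1 : `|r| < 1 by rewrite ger0_norm// ltr_pdivrMr; lra.
apply/norm_cvg0P; apply: (@squeeze_cvgr _ _ _ _ (cst 0) (geometric B r)).
- apply: nearW => n; rewrite normr_ge0 /=.
  apply: (le_trans (ler_norm_sum _ _ _)).
  apply: (@le_trans _ _ (\sum_(0 <= i < n) `|c i| * (s / 2) ^+ i * r ^+ n)).
    rewrite !big_mkord; apply: ler_sum => i _; rewrite normrM normrX -mulrA.
    rewrite ler_wpM2l// tE exprMn ler_wpM2r ?exprn_ge0//.
    by rewrite ler_wiXn2l ?(ltnW (ltn_ord i))//; lra.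
  rewrite -mulr_suml ler_wpM2r ?exprn_ge0//.
  exact: le_trans (ler_norm _) (cB n I).
- exact: cvg_cst.
- exact: cvg_geometric.
Unshelve. all: by end_near. Qed.

(** Taking partial sums divides the generating function by [1 - t], so the
    original coefficients are recovered by expanding [(1 - t) ^+ m]. *)
Lemma iter_partial_sums_inv m c n :
  c n = \sum_(0 <= j < n.+1)
    (-1) ^+ j * 'C(m, j)%:R * iter m partial_sums c (n - j)%N.
Proof.
elim: m c n => [|m IHm] c n.
  rewrite big_nat_recl//= expr0 bin0 !mul1r subn0 big1 ?addr0// => j _.
  by rewrite bin0n mulr0 mul0r.
have -> : c n = partial_sums c n - shift_coef (partial_sums c) n.
  rewrite /partial_sums; case: n => [|n] /=; first by rewrite subr0 big_nat1.
  by rewrite [in RHS]big_nat_recr//= addrAC subrr add0r.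
rewrite iterSr; move: (partial_sums c) => {}c.
case: n => [|n] /=.
  by rewrite subr0 IHm !big_nat1 !bin0.
rewrite IHm (IHm _ n) !(@big_nat_recl _ _ _ n.+1)//= !bin0 -addrA; congr (_ + _).
rewrite -sumrB; apply: eq_bigr => j _.
by rewrite binS natrD subSS exprS; ring.
Qed.

Lemma iter_shift_coef c r n : iter r shift_coef c (n + r)%N = c n.
Proof. by elim: r => [|r IHr]; rewrite ?addn0// addnS. Qed.

Lemma psum_near0_iter_shift c f r :
  psum_near0 c f -> psum_near0 (iter r shift_coef c) (fun t => t ^+ r * f t).
Proof.
move=> cf; elim: r => [|r IHr] /=.
  by under [X in psum_near0 _ X]eq_fun do rewrite mul1r.
under [X in psum_near0 _ X]eq_fun do rewrite exprS -mulrA.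
exact: psum_near0_shift.
Qed.

Lemma psum_near0_iter_partial_sums c f m :
  psum_near0 c f ->
  psum_near0 (iter m partial_sums c) (fun t => f t / (1 - t) ^+ m).
Proof.
move=> cf; elim: m => [|m IHm] /=.
  by under [X in psum_near0 _ X]eq_fun do rewrite expr0 divr1.
under [X in psum_near0 _ X]eq_fun do rewrite exprSr invfM mulrA.
exact: psum_near0_partial_sums.
Qed.

End PowerSeries.

(** * Bounds on the degenerate exponential series *)

Section DegenerateExponential.
Context {R : realType}.
Implicit Types (c lambda x t : R).

Lemma exprn_le_fact_expR x k : 0 <= x -> x ^+ k <= k`!%:R * expR x.
Proof.
move=> x_ge0; have k_gt0 : 0 < k`!%:R :> R by rewrite ltr0n fact_gt0.
rewrite mulrC -ler_pdivrMr//; case: k {k_gt0} => [|k].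
  by rewrite expr0 divr1; apply: le_trans (expR_ge1Dx x); rewrite lerDl.
by apply: le_trans (expR_ge1Dxn k x_ge0); rewrite lerDr.
Qed.

(** The parameter [c] trades the growth rate in [x] against the radius of
    convergence: it can be taken as small as the exponential moments of a
    random variable require. *)
Lemma degen_falling_bound c lambda x k : 0 < c ->
  `|degen_falling lambda x k| <=
  k`!%:R * (expR (c * `|lambda|) / c) ^+ k * expR (c * `|x|).
Proof.
move=> c_gt0; pose y := `|x| + k%:R * `|lambda|.
have y_ge0 : 0 <= y by rewrite addr_ge0// mulr_ge0.
apply: (@le_trans _ _ (y ^+ k)).
  rewrite -[k in y ^+ k]subn0 -prodr_const_nat normr_prod !big_mkord.
  apply: ler_prod => i _; rewrite normr_ge0/=.
  apply: (le_trans (ler_normB _ _)); rewrite lerD2l normrM normr_nat.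
  by rewrite ler_wpM2r// ler_nat ltnW.
have cy_ge0 : 0 <= c * y by rewrite mulr_ge0// ltW.
have := exprn_le_fact_expR (c * y) k cy_ge0.
rewrite exprMn -ler_pdivlMl ?exprn_gt0// => /le_trans; apply.
have -> : expR (c * y) = expR (c * `|x|) * expR (c * `|lambda|) ^+ k.
  by rewrite /y mulrDr expRD mulrCA expRM_natl.
by rewrite expr_div_n le_eqVlt; apply/orP; left; apply/eqP; ring.
Qed.

Lemma degen_term_bound c lambda x t k : 0 < c ->
  `|t| * (expR (c * `|lambda|) / c) <= 1 / 2 ->
  `|degen_falling lambda x k * (t ^+ k / k`!%:R)|
    <= geometric (expR (c * `|x|)) (1 / 2) k.
Proof.
move=> c_gt0 ht; set q := expR (c * `|lambda|) / c in ht.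
have q_gt0 : 0 < q by rewrite divr_gt0// expR_gt0.
have k_gt0 : 0 < k`!%:R :> R by rewrite ltr0n fact_gt0.
rewrite normrM normrM normfV normr_nat normrX /=.
apply: (@le_trans _ _ (expR (c * `|x|) * (`|t| * q) ^+ k)); last first.
  by rewrite ler_wpM2l ?expR_ge0// lerXn2r// nnegrE mulr_ge0// ltW.
rewrite mulrA ler_pdivrMr//.
have tk_ge0 : 0 <= `|t| ^+ k by rewrite exprn_ge0.
have := ler_wpM2r tk_ge0 (degen_falling_bound c lambda x k c_gt0).
move=> /le_trans; apply; rewrite -/q.
by rewrite [in leRHS]exprMn le_eqVlt; apply/orP; left; apply/eqP; ring.
Qed.

Lemma series_degen_bound c lambda x t n : 0 < c ->
  `|t| * (expR (c * `|lambda|) / c) <= 1 / 2 ->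
  `|series (fun k => degen_falling lambda x k * (t ^+ k / k`!%:R)) n|
    <= 2 * expR (c * `|x|).
Proof.
move=> c_gt0 ht; rewrite /series /=.
apply: (le_trans (ler_norm_sum _ _ _)).
apply: (@le_trans _ _ (series (geometric (expR (c * `|x|)) (1 / 2)) n)).
  by apply: ler_sum => k _; exact: degen_term_bound.
have half_neq1 : 1 / 2 != 1 :> R by apply/eqP; lra.
rewrite geometric_seriesE//.
have -> : 1 - 1 / 2 = 2^-1 :> R by field.
rewrite /= invrK -mulrA mulrC ler_wpM2r ?expR_ge0// ler_piMl// gerBl.
Qed.

Lemma cvg_series_degen c lambda x t : 0 < c ->
  `|t| * (expR (c * `|lambda|) / c) <= 1 / 2 ->
  [series degen_falling lambda x k * (t ^+ k / k`!%:R)]_k @ \oo -->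
    degen_exp lambda x t.
Proof.
move=> c_gt0 ht; apply: normed_cvg.
apply: (@series_le_cvg _ _ (geometric (expR (c * `|x|)) (1 / 2))).
- by move=> k; exact: normr_ge0.
- by move=> k; rewrite /= mulr_ge0 ?expR_ge0 ?exprn_ge0.
- by move=> k; exact: degen_term_bound.
- by apply: is_cvg_geometric_series; rewrite ger0_norm; lra.
Qed.

End DegenerateExponential.

(** * Expectation of the degenerate exponential *)

Section Expectation.
Context {d : measure_display} {T : measurableType d} {R : realType}.
Context {P : probability T R} {X : T -> R} {c : R} (lambda : R).
Context (mX : measurable_fun [set: T] X) (c_gt0 : 0 < c).
Context (iX : P.-integrable [set: T] (fun w => (expR (c * `|X w|))%:E)).

Lemma measurable_degen_falling k :
  measurable_fun [set: T] (fun w => degen_falling lambda (X w) k).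
Proof.
apply: measurable_prod => i _.
by apply: measurable_funB => //; exact: measurable_cst.
Qed.

Lemma integrable_degen_falling k :
  P.-integrable [set: T] (fun w => (degen_falling lambda (X w) k)%:E).
Proof.
pose q := expR (c * `|lambda|) / c.
apply: le_integrable (integrableZl measurableT (k`!%:R * q ^+ k) iX) => //.
  by apply/measurable_EFinP; exact: measurable_degen_falling.
move=> w _; rewrite -EFinM !abse_EFin lee_fin [leRHS]ger0_norm.
  exact: degen_falling_bound.
by rewrite mulr_ge0 ?expR_ge0// mulr_ge0// exprn_ge0// divr_ge0 ?expR_ge0// ltW.
Qed.

Lemma cvg_expectation_degen_exp t :
  `|t| * (expR (c * `|lambda|) / c) <= 1 / 2 ->
  'E_P[fun w => degen_exp lambda (X w) t]%E \is a fin_num /\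
  pseries
    (fun k => fine 'E_P[fun w => degen_falling lambda (X w) k]%E / k`!%:R) t
    @ \oo --> fine 'E_P[fun w => degen_exp lambda (X w) t]%E.
Proof.
move=> ht.
pose u n w :=
  (series (fun k => degen_falling lambda (X w) k * (t ^+ k / k`!%:R)) n)%:E.
have iterm k : P.-integrable [set: T]
    (fun w => ((t ^+ k / k`!%:R)%:E * (degen_falling lambda (X w) k)%:E)%E).
  by apply: integrableZl => //; exact: integrable_degen_falling.
have uE n : u n = (fun w => \sum_(0 <= k < n)
    ((t ^+ k / k`!%:R)%:E * (degen_falling lambda (X w) k)%:E))%E.
  apply/funext => w; rewrite /u /series /= -sumEFin.
  by apply: eq_bigr => k _; rewrite -EFinM mulrC.
have iu n : P.-integrable [set: T] (u n).
  by rewrite uE; apply: integrable_sum => // k _; exact: iterm.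
have mu n : measurable_fun [set: T] (u n) := measurable_int _ (iu n).
have uX w : [set: T] w -> u ^~ w @ \oo --> (degen_exp lambda (X w) t)%:E.
  by move=> _; apply: cvg_EFin; [exact: nearW|exact: cvg_series_degen ht].
have mexp : measurable_fun [set: T] (fun w => (degen_exp lambda (X w) t)%:E).
  exact: emeasurable_fun_cvg mu uX.
have [iexp _ lim_u] := dominated_convergence measurableT mu mexp (aeW _ uX)
  (integrableZl measurableT 2 iX)
  (aeW P (fun w n _ => series_degen_bound _ _ (X w) _ n c_gt0 ht)).
have Efin : 'E_P[fun w => degen_exp lambda (X w) t]%E \is a fin_num.
  by rewrite unlock; exact: integrable_fin_num.
have Iu n : (\int[P]_w u n w = (pseries
    (fun k => fine 'E_P[fun w => degen_falling lambda (X w) k] / k`!%:R) t n)%:E)%E.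
  rewrite uE integral_sum// /pseries /series /= -sumEFin; apply: eq_bigr => k _.
  rewrite integralZl//; last exact: integrable_degen_falling.
  have /fineK <- : (\int[P]_w (degen_falling lambda (X w) k)%:E)%E \is a fin_num.
    by apply: integrable_fin_num => //; exact: integrable_degen_falling.
  by rewrite -EFinM unlock mulrC mulrAC -!mulrA.
split=> //; move: lim_u; rewrite (_ : [sequence _]_n = EFin \o pseries
    (fun k => fine 'E_P[fun w => degen_falling lambda (X w) k]%E / k`!%:R) t).
  by rewrite -[X in _ --> X](fineK (_ : _ \is a fin_num)) => [/fine_cvgP[]//|];
    move: Efin; rewrite unlock.
by apply/funext => n; exact: Iu.
Qed.

End Expectation.

(** [exp (c |Y|)] is at most [exp (c Y) + exp (- c Y)], so both one-sided
    exponential moments are used. *)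
Lemma integrable_expR_norm {d : measure_display} {T : measurableType d}
    {R : realType} {P : probability T R} {Y : {RV P >-> R}} : finite_mgf_near0 Y ->
  exists2 c : R, 0 < c &
    P.-integrable [set: T] (fun w => (expR (c * `|Y w|))%:E).
Proof.
move=> /nbhs_ballP[e /= e_gt0 mgfY].
have mY : measurable_fun [set: T] Y by [].
have iexp c : `|c| < e -> P.-integrable [set: T] (fun w => (expR (c * Y w))%:E).
  move=> ce; apply/integrableP; split.
    apply/measurable_EFinP; apply: measurableT_comp => //.
    by apply: measurable_funM => //; exact: measurable_cst.
  have := mgfY c; rewrite /ball /= sub0r normrN => /(_ ce).
  rewrite /mmt_gen_fun unlock; congr (_ < _)%E; apply: eq_integral => w _.
  by rewrite /= ger0_norm ?expR_ge0//= mulrC.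
have c_gt0 : 0 < e / 2 by rewrite divr_gt0.
have pos_e : `|e / 2| < e by rewrite gtr0_norm//; lra.
have neg_e : `|- (e / 2)| < e by rewrite normrN.
exists (e / 2) => //.
apply: le_integrable (integrableD measurableT (iexp _ pos_e) (iexp _ neg_e)) => //.
- apply/measurable_EFinP; apply: measurableT_comp => //.
  apply: measurable_funM; first exact: measurable_cst.
  exact: measurableT_comp.
- move=> w _; rewrite -EFinD !abse_EFin lee_fin (ger0_norm (expR_ge0 _)).
  rewrite ger0_norm ?addr_ge0 ?expR_ge0//.
  have [Yw_ge0|Yw_lt0] := lerP 0 (Y w).
    by rewrite (ger0_norm Yw_ge0) lerDl expR_ge0.
  by rewrite (ltr0_norm Yw_lt0) mulrN mulNr lerDr expR_ge0.
Qed.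

(** * The derangement numbers *)

Section Derangement.
Context {d : measure_display} {T : measurableType d} {R : realType}.
Context {P : probability T R} {Y : {RV P >-> R}} (lambda : R).
Context (mgfY : finite_mgf_near0 Y).

Let moment k : R := fine 'E_P[fun w => degen_falling lambda (- Y w) k]%E.
Let moment_egf t : R := fine 'E_P[fun w => degen_exp lambda (- Y w) t]%E.

Let measurable_oppY : measurable_fun [set: T] (fun w => - Y w).
Proof. exact: measurableT_comp. Qed.

Let integrable_expR_norm_oppY :
  exists2 c : R, 0 < c &
    P.-integrable [set: T] (fun w => (expR (c * `|- Y w|))%:E).
Proof.
have [c c_gt0 iY] := integrable_expR_norm mgfY; exists c => //.
by under [X in P.-integrable _ X]eq_fun do rewrite normrN.
Qed.

Lemma expectation_degen_risingE n :
  'E_P[fun w => degen_rising lambda (Y w) n]%E = ((-1) ^+ n * moment n)%:E.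
Proof.
have [c c_gt0 iX] := integrable_expR_norm_oppY.
have intX := integrable_degen_falling lambda measurable_oppY c_gt0 iX n.
rewrite EFinM /moment fineK; last by rewrite unlock; exact: integrable_fin_num.
rewrite unlock -integralZl//; apply: eq_integral => w _; rewrite -EFinM.
congr EFin; rewrite /degen_rising /degen_falling -[n in (-1) ^+ n]subn0.
rewrite -prodr_const_nat -big_split /=; apply: eq_bigr => i _; ring.
Qed.

Lemma expectation_degen_exp_psum :
  (\forall t \near (0 : R),
     'E_P[fun w => degen_exp lambda (- Y w) t]%E \is a fin_num) /\
  psum_near0 (fun k => moment k / k`!%:R) moment_egf.
Proof.
have [c c_gt0 iX] := integrable_expR_norm_oppY.
pose q := expR (c * `|lambda|) / c.
have q_gt0 : 0 < q by rewrite divr_gt0 ?expR_gt0.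
have near_q : \forall t \near (0 : R), `|t| * q <= 1 / 2.
  have half_q : 0 < 1 / 2 / q by rewrite divr_gt0// divr_gt0.
  apply: filterS (@nbhs0_lt _ R _ half_q) => t t_lt.
  by rewrite -ler_pdivlMr// ltW.
by split; apply: filterS near_q => t ht;
  have [] := cvg_expectation_degen_exp lambda measurable_oppY c_gt0 iX t ht.
Qed.

(** Near [0] the expectation is finite, so that the equation between extended
    reals is an equation between real power series. *)
Lemma derangement_genfunP r a :
  derangement_genfun lambda r Y a <->
  psum_near0 (fun n => a n / n`!%:R)
    (fun t => t ^+ r * (moment_egf t / (1 - t) ^+ r.+1)).
Proof.
have [fin_egf _] := expectation_degen_exp_psum.
have aE t :
    [series a n * (t ^+ n / n`!%:R)]_n = pseries (fun n => a n / n`!%:R) t.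
  apply/funext => n; rewrite /pseries /series /=.
  by apply: eq_bigr => i _; rewrite mulrA mulrAC.
have rhsE t : 'E_P[fun w => degen_exp lambda (- Y w) t]%E \is a fin_num ->
   ((t ^+ r / (1 - t) ^+ r.+1)%:E *
     'E_P[fun w => degen_exp lambda (- Y w) t] =
   (t ^+ r * (moment_egf t / (1 - t) ^+ r.+1))%:E)%E.
  by move=> /fineK <-; rewrite -EFinM -/(moment_egf t) mulrAC -mulrA.
split=> genfun; apply: filterS2 fin_egf genfun => t fin_t; rewrite /= aE rhsE//.
  by move=> [cvg_a [<-]].
move=> cvg_a; split; first by apply/cvg_ex; eexists; exact: cvg_a.
by congr EFin; exact: cvg_lim.
Qed.

(** The shifted iterated partial sums have the defining generating function,
    so the choice in the definition is not the default one, and uniqueness of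
    power series identifies it. *)
Lemma prob_degen_derangementE r n :
  prob_degen_derangement lambda r Y n / n`!%:R =
  iter r shift_coef (iter r.+1 partial_sums (fun k => moment k / k`!%:R)) n.
Proof.
set b := iter r _ _.
have psum_b : psum_near0 b (fun t => t ^+ r * (moment_egf t / (1 - t) ^+ r.+1)).
  apply/psum_near0_iter_shift/psum_near0_iter_partial_sums.
  exact: (proj2 expectation_degen_exp_psum).
have fact_neq0 k : k`!%:R != 0 :> R by rewrite pnatr_eq0 -lt0n fact_gt0.
have genfun_b : derangement_genfun lambda r Y (fun k => b k * k`!%:R).
  apply/derangement_genfunP.
  by under [X in psum_near0 X _]eq_fun do rewrite mulfK//.
have := xgetPex (fun=> 0)
  (ex_intro [set a | derangement_genfun lambda r Y a] _ genfun_b).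
move=> /derangement_genfunP psum_d.
exact: (psum_near0_unique _ _ _ psum_d psum_b n).
Qed.

End Derangement.

Theorem theorem2p9 (d : measure_display) (T : measurableType d)
    (R : realType) (P : probability T R) (Y : {RV P >-> R}) (lambda : R)
    (lambda_neq0 : lambda != 0) (mgfY : finite_mgf_near0 Y) (n r : nat) :
  ('E_P[fun w => degen_rising lambda (Y w) n] =
   (n`!%:R * \sum_(0 <= k < n.+1)
      prob_degen_derangement lambda r Y (k + r)%N / ((k + r)`!)%:R
      * (-1) ^+ k * 'C(r.+1, n - k)%:R)%R%:E)%E.
Proof.
pose m k := fine 'E_P[fun w => degen_falling lambda (- Y w) k]%E / k`!%:R.
pose e := iter r.+1 partial_sums m.
have dE k : prob_degen_derangement lambda r Y (k + r)%N / ((k + r)`!)%:R = e k.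
  by rewrite (prob_degen_derangementE _ mgfY) iter_shift_coef.
have mE : fine 'E_P[fun w => degen_falling lambda (- Y w) n]%E = n`!%:R * m n.
  by rewrite mulrC divfK// pnatr_eq0 -lt0n fact_gt0.
rewrite (expectation_degen_risingE _ mgfY) mE; congr EFin.
rewrite mulrCA; congr (_ * _); rewrite (iter_partial_sums_inv r.+1 m) -/e.
(* The index [k] of the statement is [n - j]. *)
rewrite mulr_sumr [RHS]big_nat_rev !big_mkord; apply: eq_bigr => j _.
have jn : (j <= n)%N by rewrite -ltnS.
rewrite add0n subSS dE subKn//.
have -> : (-1) ^+ (n - j) = (-1) ^+ n * (-1) ^+ j :> R.
  by rewrite -signr_odd oddB// -exprD -[RHS]signr_odd oddD.
ring.
Qed.
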